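(* Let $\mathbb{K}$ be an infinite field with algebraic closure $\overline{\mathbb{K}}$, and let $d\ge 1$ and $n\ge d+1$ be integers. For $V$ a generic $n\times d$ Toeplitz matrix with entries in $\mathbb{K}$, $\xi^*\in\mathbb{K}^d$ a generic $d\times 1$ vector, $\Pi$ an $n\times n$ permutation matrix, and $y=\Pi V\xi^*$, the polynomial system in the unknowns $x=(x_1,\dots,x_d)^\top$ $$p_\ell(Vx)=p_\ell(y),\qquad \ell=1,\dots,d+1,$$ admits $\xi^*$ as its unique solution (in $\overline{\mathbb{K}}^d$).
   Context: For a positive integer $\ell$, $p_\ell(z)=z_1^\ell+\cdots+z_n^\ell$ is the $\ell$-th power-sum polynomial in $n$ variables. A matrix is Toeplitz if its $(i,j)$ entry depends only on $i-j$. ''Generic'' means: there is a dense Zariski-open subset $\mathscr{U}$ of the affine space of $n\times d$ Toeplitz matrices over $\mathbb{K}$ such that for every $V\in\mathscr{U}$ there is a dense Zariski-open subset $\mathscr{W}_V\subseteq\mathbb{K}^d$ such that the statement holds for every $\xi^*\in\mathscr{W}_V$ (and every permutation matrix $\Pi$; note that $p_\ell(y)=p_\ell(V\xi^* )$ does not depend on $\Pi$).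
   Formalization: For d ≥ 2 the field K is additionally assumed to have characteristic 0 or greater than d+1; in smaller characteristic p the equations satisfy p_{pm} = (p_m)^p and become redundant, so that uniqueness fails generically (e.g. d = 2, n = 3, characteristic 2). *)

(* Defs.v *)
From HB Require Import structures.
From mathcomp Require Import all_boot all_order all_fingroup all_algebra.
From mathcomp.multinomials Require Import mpoly.

Set Implicit Arguments.
Unset Strict Implicit.
Unset Printing Implicit Defensive.

Import GRing.Theory.
Local Open Scope ring_scope.

Definition infinite_type (T : eqType) : Prop :=
  forall s : seq T, exists x : T, x \notin s.

Section Zariski.
Variables (K : fieldType) (m n : nat).

(* A polynomial function on the affine space 'M[K]_(m, n): the m * n variables
   stand for the entries of A, in the order given by mxvec. *)
Definition mx_eval (A : 'M[K]_(m, n)) (p : {mpoly K[m * n]}) : K :=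
  p.@[fun k => mxvec A 0 k].

Definition zero_locus (S : {mpoly K[m * n]} -> Prop) (A : 'M[K]_(m, n)) : Prop :=
  forall p, S p -> mx_eval A p = 0.

Definition zariski_closed (Z : 'M[K]_(m, n) -> Prop) : Prop :=
  exists S, forall A, Z A <-> zero_locus S A.

(* Openness and density are relative to X, with the subspace topology. *)
Definition zariski_open_in (X U : 'M[K]_(m, n) -> Prop) : Prop :=
  exists2 Z, zariski_closed Z & forall A, U A <-> X A /\ ~ Z A.

Definition zariski_dense_in (X U : 'M[K]_(m, n) -> Prop) : Prop :=
  forall Z, zariski_closed Z -> (forall A, U A -> Z A) -> forall A, X A -> Z A.

Definition generically (X P : 'M[K]_(m, n) -> Prop) : Prop :=
  exists U, [/\ zariski_open_in X U, zariski_dense_in X U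
              & forall A, U A -> P A].

End Zariski.

Definition toeplitz (K : fieldType) (n d : nat) (V : 'M[K]_(n, d)) : Prop :=
  forall (i i' : 'I_n) (j j' : 'I_d),
    i%:Z - j%:Z = i'%:Z - j'%:Z -> V i j = V i' j'.

Definition power_sum (R : pzRingType) (n l : nat) (z : 'cV[R]_n) : R :=
  \sum_i z i 0 ^+ l.

(* Main.v *)
Require Import Defs.
From HB Require Import structures.
From mathcomp Require Import all_boot all_order all_fingroup all_algebra.
From mathcomp.multinomials Require Import mpoly.
From mathcomp Require Import zify ring.

Set Implicit Arguments.
Unset Strict Implicit.
Unset Printing Implicit Defensive.

Import GRing.Theory.
Local Open Scope ring_scope.

(** Uniqueness of the solution is shown at one
    well-chosen pair (V0, xi0), in a form strong enough to survive small
    Zariski perturbations of the pair, and is then spread out to a generic one.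

    The form in question is a certificate ([certified]): for some degree D,
    every monomial x^m of degree at most D satisfies
      x^m - xi0^m = sum over l of q_(m,l)(x) (p_l(V0 x) - p_l(V0 xi0)),
    where no product q_(m,l) p_l has degree above D.  Keep the cofactors
    q_(m,l) and replace (V0, xi0) by an arbitrary (V, xi).  The polynomials
      xi0^m + sum over l of q_(m,l)(x) (p_l(V x) - p_l(V xi))
    still have degree at most D, and their matrix N(V, xi) of coefficients on
    the monomials of degree at most D is square, depends polynomially on
    (V, xi), and is the identity at (V0, xi0).  A solution x of the system for
    (V, xi) gives these polynomials the values xi0^m; so does xi.  Hence N(V, xi)
    kills the vector of all x^m - xi^m, and x = xi as soon as det N(V, xi) is
    not zero ([spread_unique]).  This condition is open, and it is dense because
    it holds at (V0, xi0) and K is infinite ([generically_nonvanishing]).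

    The degree bound in the certificate is what makes N square.  It is obtained
    from two facts ([exists_certificate]): the ideal I of all
    p_l(V0 x) - p_l(V0 xi0) contains every x_j - (xi0)_j, with no control on
    degrees; and a power of each x_j is a combination of the p_l(V0 x) that
    respects degrees, that is, the system has no solution at infinity.

    For V0 take q on the diagonal, -1 just below it and zeros elsewhere.  Only
    the first d + 1 entries y_0, ..., y_d of V0 x are not zero, and they obey the
    single relation sum q^i y_i = 0.  As there are d + 1 of them, their d + 1
    power sums determine them up to order, by Newton's identities: if c_i are
    the values of y_i at xi0, then I contains the product over j of (y_i - c_j)
    for each i, so modulo I the y_i take values among the c_j
    ([ideal_split_seq]), and these values are a permutation of the c_j.  The
    linear relation leaves only the identity permutation, provided xi0 avoids
    finitely many hyperplanes ([exists_separating_vector]); so I contains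
    y_i - c_i, and from these x_j - (xi0)_j.  Newton's identities also give that
    y_i^(d+1) is a combination of the power sums, so the y_i, and hence the x_j,
    are nilpotent modulo the power sums.  They require dividing by the integers
    up to d + 1; for d = 1 the first power sum alone determines x, in any
    characteristic. *)

(** * Polynomials in one variable over an infinite field *)

Lemma infinite_uniq_seq (T : eqType) (N : nat) :
  infinite_type T -> exists2 s : seq T, uniq s & size s = N.
Proof.
move=> infT; elim: N => [|N [s us <-]]; first by exists [::].
by have [x xs] := infT s; exists (x :: s); rewrite //= xs.
Qed.

Lemma exists_nonroot (K : fieldType) (p : {poly K}) :
  infinite_type K -> p != 0 -> exists x, p.[x] != 0.
Proof.
move=> infK p0; have [s us sz] := infinite_uniq_seq (size p) infK.
case: (boolP (all (root p) s)) => [rs|/allPn[x _ px]]; last by exists x.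
by have := max_poly_roots p0 rs us; rewrite sz ltnn.
Qed.

Lemma vanishing_poly (K : fieldType) (p : {poly K}) :
  infinite_type K -> (forall x, p.[x] = 0) -> p = 0.
Proof.
move=> infK p0; apply/eqP/negPn/negP => /(exists_nonroot infK)[x].
by rewrite p0 eqxx.
Qed.

(** * Generic properties on spaces of matrices *)

Section PolynomialFunctions.
Variables (K : fieldType) (m n : nat).
Implicit Types (A B : 'M[K]_(m, n)) (p : {mpoly K[m * n]}).

Definition segment A B (s : K) : 'M[K]_(m, n) := A + s *: (B - A).

Lemma mx_eval_segment p A B :
  exists r : {poly K}, forall s, r.[s] = mx_eval (segment A B s) p.
Proof.
exists (\sum_(e <- msupp p) (p@_e)%:P * \prod_k
  ((mxvec A 0 k)%:P + 'X * (mxvec (B - A) 0 k)%:P) ^+ e k) => s.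
rewrite /mx_eval mevalE horner_sum; apply: eq_bigr => e _.
rewrite hornerM hornerC horner_prod; congr (_ * _); apply: eq_bigr => k _.
rewrite horner_exp hornerD hornerM hornerX !hornerC.
by case/mxvec_indexP: k => i j; rewrite !mxvecE !mxE.
Qed.

(** Density is tested along segments: a polynomial that vanishes wherever p does
    not gives, on the segment from A to A0, a univariate polynomial whose
    product with p is zero; p being nonzero at A0, the other factor is zero. *)
Lemma generically_nonvanishing (X P : 'M[K]_(m, n) -> Prop) p A0 :
    infinite_type K ->
    (forall A B s, X A -> X B -> X (segment A B s)) ->
    X A0 -> mx_eval A0 p != 0 ->
    (forall A, X A -> mx_eval A p != 0 -> P A) ->
  generically X P.
Proof.
move=> infK segX XA0 pA0 XpP.
exists (fun A => X A /\ mx_eval A p <> 0); split.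
- exists (fun A => mx_eval A p = 0) => //; exists (eq p) => A.
  by split=> [pA _ <-|/(_ p erefl)].
- move=> Z [S defZ] sUZ A XA; apply/defZ => g Sg.
  have [r rE] := mx_eval_segment p A A0; have [t tE] := mx_eval_segment g A A0.
  have rt0 : t * r = 0.
    apply: vanishing_poly => // s; rewrite hornerM.
    have [->|rs] := eqVneq r.[s] 0; first by rewrite mulr0.
    have /sUZ/defZ/(_ g Sg) : X (segment A A0 s) /\ mx_eval (segment A A0 s) p <> 0.
      by split; [exact: segX | apply/eqP; rewrite -rE].
    by rewrite -tE => ->; rewrite mul0r.
  move/eqP: rt0; rewrite mulf_eq0 => /orP[/eqP t0|/eqP r0].
    by have := tE 0; rewrite t0 horner0 /segment scale0r addr0.
  have := rE 1; rewrite r0 horner0 /segment scale1r addrC subrK => /esym/eqP.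
  by rewrite (negbTE pA0).
- by move=> A [XA /eqP pA]; apply: XpP.
Qed.

Definition polynomial_fun (g : 'M[K]_(m, n) -> K) :=
  exists p, forall A, mx_eval A p = g A.

Lemma polynomial_fun_const c : polynomial_fun (fun=> c).
Proof. by exists c%:MP => A; rewrite /mx_eval mevalC. Qed.

Lemma polynomial_fun_entry i j : polynomial_fun (fun A => A i j).
Proof. by exists 'X_(mxvec_index i j) => A; rewrite /mx_eval mevalXU mxvecE. Qed.

Lemma polynomial_funD g h : polynomial_fun g -> polynomial_fun h ->
  polynomial_fun (fun A => g A + h A).
Proof.
move=> [p pE] [q qE]; exists (p + q) => A.
by rewrite /mx_eval mevalD -/(mx_eval A p) -/(mx_eval A q) pE qE.
Qed.

Lemma polynomial_funM g h : polynomial_fun g -> polynomial_fun h ->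
  polynomial_fun (fun A => g A * h A).
Proof.
move=> [p pE] [q qE]; exists (p * q) => A.
by rewrite /mx_eval mevalM -/(mx_eval A p) -/(mx_eval A q) pE qE.
Qed.

Lemma polynomial_fun_sum I (r : seq I) (Q : pred I) (g : I -> 'M[K]_(m, n) -> K) :
    (forall i, polynomial_fun (g i)) ->
  polynomial_fun (fun A => \sum_(i <- r | Q i) g i A).
Proof.
move=> gP; elim: r => [|i r IHr].
  by have [p pE] := polynomial_fun_const 0; exists p => A; rewrite big_nil.
have [p pE] := IHr; have [q qE] := polynomial_funD (gP i) IHr.
by case Qi: (Q i); [exists q|exists p] => A; rewrite big_cons Qi.
Qed.

Lemma polynomial_fun_prod I (r : seq I) (g : I -> 'M[K]_(m, n) -> K) :
    (forall i, polynomial_fun (g i)) ->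
  polynomial_fun (fun A => \prod_(i <- r) g i A).
Proof.
move=> gP; elim: r => [|i r IHr].
  by have [p pE] := polynomial_fun_const 1; exists p => A; rewrite big_nil.
by have [q qE] := polynomial_funM (gP i) IHr; exists q => A; rewrite big_cons.
Qed.

Lemma polynomial_funX g e : polynomial_fun g -> polynomial_fun (fun A => g A ^+ e).
Proof.
move=> gP; have [p pE] := polynomial_fun_prod (index_iota 0 e) (fun=> gP).
by exists p => A; rewrite pE prodr_const_nat subn0.
Qed.

Lemma polynomial_fun_det k (N : 'M[K]_(m, n) -> 'M[K]_k) :
    (forall i j, polynomial_fun (fun A => N A i j)) ->
  polynomial_fun (fun A => \det (N A)).
Proof.
move=> NP; apply: polynomial_fun_sum => s.
apply: polynomial_funM; first exact: polynomial_fun_const.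
by apply: polynomial_fun_prod => i; apply: NP.
Qed.

Definition polynomial_coefs d (g : 'M[K]_(m, n) -> {mpoly K[d]}) :=
  forall e, polynomial_fun (fun A => (g A)@_e).

Section Coefs.
Variable d : nat.
Implicit Types g h : 'M[K]_(m, n) -> {mpoly K[d]}.

Lemma polynomial_coefs_const (c : {mpoly K[d]}) : polynomial_coefs (fun=> c).
Proof. by move=> e; apply: polynomial_fun_const. Qed.

Lemma polynomial_coefsC (g : 'M[K]_(m, n) -> K) :
  polynomial_fun g -> polynomial_coefs (fun A => (g A)%:MP_[d]).
Proof.
move=> gP e; have [p pE] := polynomial_funM gP (polynomial_fun_const (e == 0%MM)%:R).
by exists p => A; rewrite mcoeffC.
Qed.

Lemma polynomial_coefsN (g : 'M[K]_(m, n) -> K) :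
  polynomial_fun g -> polynomial_coefs (fun A => - (g A)%:MP_[d]).
Proof.
move=> gP; have gNP := polynomial_funM (polynomial_fun_const (-1)) gP.
move=> e; have [p pE] := polynomial_coefsC gNP e.
by exists p => A; rewrite pE mulN1r mpolyCN.
Qed.

Lemma polynomial_coefsD g h : polynomial_coefs g -> polynomial_coefs h ->
  polynomial_coefs (fun A => g A + h A).
Proof.
move=> gP hP e; have [p pE] := polynomial_funD (gP e) (hP e).
by exists p => A; rewrite mcoeffD.
Qed.

Lemma polynomial_coefsM g h : polynomial_coefs g -> polynomial_coefs h ->
  polynomial_coefs (fun A => g A * h A).
Proof.
move=> gP hP e.
have [p pE] : polynomial_fun (fun A =>
    \sum_(k : 'X_{1..d < (mdeg e).+1, (mdeg e).+1} | e == (k.1 + k.2)%MM)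
      ((g A)@_k.1 * (h A)@_k.2)).
  by apply: polynomial_fun_sum => k; apply: polynomial_funM.
by exists p => A; rewrite pE mcoeffM.
Qed.

Lemma polynomial_coefs_sum I (r : seq I) (g : I -> 'M[K]_(m, n) -> {mpoly K[d]}) :
    (forall i, polynomial_coefs (g i)) ->
  polynomial_coefs (fun A => \sum_(i <- r) g i A).
Proof.
move=> gP e; have [p pE] := polynomial_fun_sum r xpredT (gP^~ e).
by exists p => A; rewrite pE raddf_sum.
Qed.

Lemma polynomial_coefsX g e :
  polynomial_coefs g -> polynomial_coefs (fun A => g A ^+ e).
Proof.
move=> gP; elim: e => [|e IHe]; first exact: polynomial_coefs_const.
move=> b; have [p pE] := polynomial_coefsM gP IHe b.
by exists p => A; rewrite exprS.
Qed.

End Coefs.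
End PolynomialFunctions.
Arguments polynomial_fun_const {K m n} c.
Arguments polynomial_fun_entry {K m n} i j.
Arguments polynomial_coefs_const {K m n d} c.

(** * Linear algebra on spaces of polynomials of bounded degree *)

Section Rigidity.
Variables (K : fieldType) (L : fieldType) (d D : nat).
Local Notation T := 'X_{1..d < D.+1}.

Let mon (i : 'I_#|{: T}|) : T := enum_val i.

Definition coef_matrix (h : T -> {mpoly K[d]}) : 'M[K]_#|{: T}| :=
  \matrix_(i, j) (h (mon i))@_(mon j).

(** The differences phi x^a - psi x^a form a vector in the kernel of the image of
    the coefficient matrix, since phi and psi give the h a the same values. *)
Lemma coef_matrix_inj (phi psi : {rmorphism {mpoly K[d]} -> L}) (h : T -> {mpoly K[d]}) :
    (forall c, phi c%:MP = psi c%:MP) ->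
    (forall a, msize (h a) <= D.+1)%N ->
    \det (coef_matrix h) != 0 ->
    (forall a, phi (h a) = psi (h a)) ->
  forall a : T, phi 'X_[a] = psi 'X_[a].
Proof.
move=> eqC szh detN eqh.
pose f := phi \o @mpolyC d K : {rmorphism K -> L}.
pose N := map_mx f (coef_matrix h).
pose u : 'cV[L]_#|{: T}| := \col_j (phi 'X_[mon j] - psi 'X_[mon j]).
have Nu0 : N *m u = 0.
  apply/colP => i; rewrite !mxE; set a := mon i.
  have expand (chi : {rmorphism {mpoly K[d]} -> L}) : (forall c, chi c%:MP = f c) ->
      chi (h a) = \sum_j f (h a)@_(mon j) * chi 'X_[mon j].
    move=> chiC; rewrite {1}(mpolywE (szh a)) rmorph_sum /=.
    rewrite (reindex _ (onW_bij _ (enum_val_bij T))) /=.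
    by apply: eq_bigr => j _; rewrite -mul_mpolyC rmorphM chiC.
  have := eqh a; rewrite (expand phi) // (expand psi) => [/eqP|c]; last by rewrite -eqC.
  rewrite -subr_eq0 -sumrB => /eqP eq0; rewrite -[RHS]eq0.
  by apply: eq_bigr => j _; rewrite !mxE mulrBr.
have unitN : N \in unitmx by rewrite unitmxE det_map_mx unitfE fmorph_eq0.
have u0 : u = 0 by rewrite -(mulKmx unitN u) Nu0 mulmx0.
move=> a; have := congr1 (fun v : 'cV_#|{: T}| => v (enum_rank a) 0) u0.
by rewrite !mxE /mon enum_rankK => /eqP; rewrite subr_eq0 => /eqP.
Qed.

End Rigidity.

(** * Degree bounds and formal power sums *)

Lemma msizeM_leq (K : fieldType) d (p q : {mpoly K[d]}) a b :
  (msize p <= a)%N -> (msize q <= b.+1)%N -> (msize (p * q) <= a + b)%N.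
Proof.
have [->|p0] := eqVneq p 0; first by rewrite mul0r msize0.
have [->|q0] := eqVneq q 0; first by rewrite mulr0 msize0.
rewrite msizeM //; move: (mmeasure _ p) (mmeasure _ q) => x y; lia.
Qed.

Lemma msizeD_leq (K : fieldType) d (p q : {mpoly K[d]}) a :
  (msize p <= a)%N -> (msize q <= a)%N -> (msize (p + q) <= a)%N.
Proof. by move=> pa qa; rewrite (leq_trans (msizeD_le p q)) // geq_max pa. Qed.

Lemma msize_sum_leq (K : fieldType) d I (r : seq I) (P : pred I)
    (F : I -> {mpoly K[d]}) a :
  (forall i, P i -> msize (F i) <= a)%N -> (msize (\sum_(i <- r | P i) F i)%R <= a)%N.
Proof.
move=> Fa; elim/big_rec: _ => [|i p Pi pa]; first by rewrite msize0.
by rewrite msizeD_leq // Fa.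
Qed.

Lemma msizeX_leq (K : fieldType) d (p : {mpoly K[d]}) a e :
  (msize p <= a.+1)%N -> (msize (p ^+ e) <= (a * e).+1)%N.
Proof.
move=> pa; elim: e => [|e IHe]; first by rewrite expr0 msize1.
by rewrite exprSr mulnS addnC -addSn msizeM_leq.
Qed.

Lemma map_power_sum (R S : pzRingType) (f : {rmorphism R -> S}) n l (z : 'cV[R]_n) :
  f (power_sum l z) = power_sum l (map_mx f z).
Proof. by rewrite rmorph_sum; apply: eq_bigr => i _; rewrite rmorphXn mxE. Qed.

Section PowerSums.
Variables (K : fieldType) (n d : nat).
Implicit Types (V : 'M[K]_(n, d)) (xi : 'cV[K]_d).

Definition formal_power_sum V l : {mpoly K[d]} :=
  power_sum l (map_mx (@mpolyC d K) V *m \col_j 'X_j).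

Lemma formal_power_sumE V l :
  formal_power_sum V l = \sum_i (\sum_j (V i j)%:MP * 'X_j) ^+ l.
Proof.
apply: eq_bigr => i _; rewrite mxE; congr (_ ^+ _).
by apply: eq_bigr => j _; rewrite !mxE.
Qed.

Lemma formal_power_sum_morph (L : fieldType) (phi : {rmorphism {mpoly K[d]} -> L})
    (f : {rmorphism K -> L}) V l :
    (forall c, phi c%:MP = f c) ->
  phi (formal_power_sum V l) = power_sum l (map_mx f V *m \col_j phi 'X_j).
Proof.
move=> phiC; rewrite map_power_sum; congr power_sum; apply/colP => i.
rewrite !mxE rmorph_sum; apply: eq_bigr => j _.
by rewrite !mxE rmorphM phiC.
Qed.

Lemma formal_power_sum_eval V l xi :
  (formal_power_sum V l).@[fun j => xi j 0] = power_sum l (V *m xi).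
Proof.
rewrite (@formal_power_sum_morph _ _ idfun) => [|c]; last by rewrite /= mevalC.
congr power_sum; congr mulmx; first by apply/matrixP => i j; rewrite mxE.
by apply/colP => j; rewrite mxE /= mevalXU.
Qed.

Lemma msize_formal_power_sum V l : (msize (formal_power_sum V l) <= l.+1)%N.
Proof.
rewrite formal_power_sumE msize_sum_leq // => i _.
rewrite -[l in l.+1]mul1n msizeX_leq ?msize_sum_leq // => j _.
by rewrite -[2%N]/(1 + 1)%N msizeM_leq ?msizeX ?mdeg1 // msizeC leq_b1.
Qed.

Lemma power_sum_polynomial_l xi l :
  polynomial_fun (fun V : 'M[K]_(n, d) => power_sum l (V *m xi)).
Proof.
apply: polynomial_fun_sum => i; apply: polynomial_funX.
have [p pE] := polynomial_fun_sum (index_enum 'I_d) xpredT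
  (fun j => polynomial_funM (polynomial_fun_entry i j) (polynomial_fun_const (xi j 0))).
by exists p => V; rewrite mxE.
Qed.

Lemma power_sum_polynomial_r V l :
  polynomial_fun (fun xi : 'cV[K]_d => power_sum l (V *m xi)).
Proof.
have entryP i : polynomial_fun (fun xi : 'cV[K]_d => (V *m xi) i 0).
  have [p pE] := polynomial_fun_sum (index_enum 'I_d) xpredT (fun j =>
    polynomial_funM (polynomial_fun_const (V i j)) (polynomial_fun_entry j (0 : 'I_1))).
  by exists p => xi; rewrite mxE.
exact: (polynomial_fun_sum _ _ (fun i => polynomial_funX l (entryP i))).
Qed.

Lemma formal_power_sum_polynomial l :
  polynomial_coefs (fun V : 'M[K]_(n, d) => formal_power_sum V l).
Proof.
have pP : polynomial_coefs (fun V : 'M[K]_(n, d) =>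
    \sum_i (\sum_j (V i j)%:MP_[d] * 'X_j) ^+ l).
  apply: polynomial_coefs_sum => i; apply: polynomial_coefsX.
  apply: polynomial_coefs_sum => j; apply: polynomial_coefsM.
    by apply: polynomial_coefsC; apply: polynomial_fun_entry.
  exact: polynomial_coefs_const.
by move=> e; have [p pE] := pP e; exists p => V; rewrite formal_power_sumE.
Qed.

Lemma power_sum_perm (Pi : 'M[K]_n) (z : 'cV[K]_n) l :
  is_perm_mx Pi -> power_sum l (Pi *m z) = power_sum l z.
Proof.
case/is_perm_mxP => s ->; rewrite -row_permE /power_sum.
by rewrite [RHS](reindex_inj (@perm_inj _ s)); apply: eq_bigr => i _; rewrite mxE.
Qed.

(** The truncated subtraction makes the condition say that q l is zero when l
    exceeds e + 1, so that zero is a combination for every e. *)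
Definition filtered_comb (g : nat -> {mpoly K[d]}) N e r :=
  exists q : nat -> {mpoly K[d]},
    (forall l, (msize (q l) <= e.+1 - l)%N) /\ r = \sum_(1 <= l < N.+1) q l * g l.

Definition centred_power_sum V xi l :=
  formal_power_sum V l - (power_sum l (V *m xi))%:MP.

Definition certified V xi N D := forall m : 'X_{1..d}, (mdeg m <= D)%N ->
  filtered_comb (centred_power_sum V xi) N D
    ('X_[m] - ('X_[m]).@[fun j => xi j 0]%:MP).

End PowerSums.

(** * Spreading uniqueness out from one point *)

Section SpreadingOut.
Variables (K : fieldType) (n d N D : nat).
Variables (V0 : 'M[K]_(n, d)) (xi0 : 'cV[K]_d).
Local Notation T := 'X_{1..d < D.+1}.
Variable q : T -> nat -> {mpoly K[d]}.
Hypothesis qD : forall a l, (msize (q a l) <= D.+1 - l)%N.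
Hypothesis qE : forall a : T,
  'X_[a] - ('X_[a]).@[fun j => xi0 j 0]%:MP
    = \sum_(1 <= l < N.+1) q a l * centred_power_sum V0 xi0 l.

Implicit Types (V : 'M[K]_(n, d)) (xi : 'cV[K]_d).

(** At (V0, xi0) these polynomials are the monomials themselves; elsewhere they
    are what the same cofactors produce. *)
Definition spread V xi (a : T) : {mpoly K[d]} :=
  ('X_[a]).@[fun j => xi0 j 0]%:MP
    + \sum_(1 <= l < N.+1) q a l * centred_power_sum V xi l.

Definition spread_det V xi := \det (coef_matrix (spread V xi)).

Lemma spread_det_base : spread_det V0 xi0 = 1.
Proof.
rewrite /spread_det -[RHS](det1 K #|{: T}|); congr determinant.
apply/matrixP => i j; rewrite !mxE /spread -qE addrC subrK mcoeffX.
by rewrite val_eqE (inj_eq enum_val_inj).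
Qed.

Lemma msize_spread V xi a : (msize (spread V xi a) <= D.+1)%N.
Proof.
rewrite msizeD_leq //; first by rewrite msizeC; case: eqP.
rewrite big_nat msize_sum_leq // => l /andP[l0 lN].
have [->|q0] := eqVneq (q a l) 0; first by rewrite mul0r msize0.
have := qD a l; have : (0 < msize (q a l))%N by rewrite lt0n msize_poly_eq0.
move=> qgt qle; have -> : D.+1 = (D.+1 - l + l)%N by lia.
rewrite msizeM_leq // msizeD_leq ?msize_formal_power_sum //.
by rewrite msizeN msizeC; case: eqP.
Qed.

Lemma spread_det_polynomial m' n' (V : 'M[K]_(m', n') -> 'M[K]_(n, d))
    (xi : 'M[K]_(m', n') -> 'cV[K]_d) :
    (forall l, polynomial_coefs (fun A => centred_power_sum (V A) (xi A) l)) ->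
  polynomial_fun (fun A => spread_det (V A) (xi A)).
Proof.
move=> gP; apply: polynomial_fun_det => i j.
have hP a : polynomial_coefs (fun A => spread (V A) (xi A) a).
  apply: polynomial_coefsD; first exact: polynomial_coefs_const.
  apply: polynomial_coefs_sum => l; apply: polynomial_coefsM => //.
  exact: polynomial_coefs_const.
have [p pE] := hP (enum_val i) (val (enum_val j : T)).
by exists p => A; rewrite mxE.
Qed.

Lemma spread_det_polynomial_l xi : polynomial_fun (fun V => spread_det V xi).
Proof.
apply: (@spread_det_polynomial _ _ id (fun=> xi)) => l; apply: polynomial_coefsD.
  exact: formal_power_sum_polynomial.
by apply: polynomial_coefsN; apply: power_sum_polynomial_l.
Qed.

Lemma spread_det_polynomial_r V : polynomial_fun (fun xi => spread_det V xi).
Proof.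
apply: (@spread_det_polynomial _ _ (fun=> V) id) => l; apply: polynomial_coefsD.
  exact: polynomial_coefs_const.
by apply: polynomial_coefsN; apply: power_sum_polynomial_r.
Qed.

(** Every solution of the system gives all the polynomials [spread V xi a] values
    that do not depend on the solution, and xi is itself a solution. *)
Lemma spread_unique (L : fieldType) (iota : {rmorphism K -> L}) V xi (x : 'cV[L]_d) :
    (0 < D)%N -> spread_det V xi != 0 ->
    (forall l, (1 <= l <= N)%N ->
       power_sum l (map_mx iota V *m x) = iota (power_sum l (V *m xi))) ->
  x = map_mx iota xi.
Proof.
move=> D0 detVxi sol.
have at_solution (z : 'cV[L]_d) : (forall l, (1 <= l <= N)%N ->
    power_sum l (map_mx iota V *m z) = iota (power_sum l (V *m xi))) ->
    forall a, mmap iota (fun j => z j 0) (spread V xi a)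
      = iota ('X_[a]).@[fun j => xi0 j 0].
  move=> zsol a; rewrite /spread rmorphD /= mmapC rmorph_sum /=.
  rewrite big_nat big1 ?addr0 // => l lN; rewrite rmorphM rmorphB /= mmapC.
  rewrite (@formal_power_sum_morph _ _ _ _ _ iota) => [|c]; last by rewrite /= mmapC.
  have -> : \col_j (mmap iota (fun j0 => z j0 0) 'X_j) = z.
    by apply/colP => j; rewrite mxE mmapX mmap1U.
  by rewrite zsol // subrr mulr0.
apply/colP => j.
have jD : (mdeg U_(j) < D.+1)%N by rewrite mdeg1.
have xi_sol l : (1 <= l <= N)%N ->
    power_sum l (map_mx iota V *m map_mx iota xi) = iota (power_sum l (V *m xi)).
  by rewrite -map_mxM map_power_sum.
have := @coef_matrix_inj K L d D (mmap iota (fun j => x j 0))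
  (mmap iota (fun j => (map_mx iota xi) j 0)) (spread V xi) _ _ detVxi _ (BMultinom jD).
rewrite /= !mmapX !mmap1U; apply.
- by move=> c; rewrite !mmapC.
- exact: msize_spread.
- by move=> a; rewrite !at_solution.
Qed.

End SpreadingOut.

(** One certificate at one pair suffices.  A matrix V is good when the
    determinant at (V, xi0) is not zero; then xi0 witnesses that the
    determinant is a nonzero function of the vector for that V. *)
Lemma generic_uniqueness (K : fieldType) (L : fieldType) (iota : {rmorphism K -> L})
    (n d N D : nat) (V0 : 'M[K]_(n, d)) (xi0 : 'cV[K]_d) :
  infinite_type K -> toeplitz V0 -> (0 < D)%N -> certified V0 xi0 N D ->
  generically (@toeplitz K n d) (fun V =>
    generically (fun _ : 'cV[K]_d => True) (fun xi =>
      forall Pi : 'M[K]_n, is_perm_mx Pi ->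
      forall y : 'cV[K]_n, y = Pi *m V *m xi ->
      forall x : 'cV[L]_d,
        (forall l : nat, (1 <= l <= N)%N ->
           power_sum l (map_mx iota V *m x) = power_sum l (map_mx iota y))
        <-> x = map_mx iota xi)).
Proof.
move=> infK toepV0 D0 cert.
have /fin_all_exists[q qP] : forall a : 'X_{1..d < D.+1}, exists qa : nat -> {mpoly K[d]},
    (forall l, (msize (qa l) <= D.+1 - l)%N) /\
    'X_[a] - ('X_[a]).@[fun j => xi0 j 0]%:MP
      = \sum_(1 <= l < N.+1) qa l * centred_power_sum V0 xi0 l.
  by move=> a; apply: cert; rewrite -ltnS bmdeg.
have [p pE] := @spread_det_polynomial_l K n d N D xi0 q xi0.
apply: (generically_nonvanishing (p := p) (A0 := V0)) => //.
- move=> A B s toepA toepB i i' j j' eqij.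
  by rewrite !mxE (toepA _ _ _ _ eqij) (toepB _ _ _ _ eqij).
- by rewrite pE spread_det_base ?oner_neq0 // => a; case: (qP a).
move=> V toepV; rewrite pE => detV.
have [r rE] := @spread_det_polynomial_r K n d N D xi0 q V.
apply: (generically_nonvanishing (p := r) (A0 := xi0)); rewrite ?rE //.
move=> xi _; rewrite rE => detVxi Pi permPi y -> x.
have psE l : power_sum l (map_mx iota (Pi *m V *m xi)) = iota (power_sum l (V *m xi)).
  by rewrite -map_power_sum -mulmxA power_sum_perm.
split=> [sol|-> l lN]; last by rewrite psE -map_mxM map_power_sum.
by apply: (spread_unique _ D0 detVxi) => [a l|l lN]; [case: (qP a) | rewrite sol].
Qed.

(** * Building a certificate *)

Lemma msize_expr (K : fieldType) d (p : {mpoly K[d]}) e :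
  (msize p <= 2)%N -> (msize (p ^+ e) <= e.+1)%N.
Proof. by move=> p2; rewrite -[e in e.+1]mul1n msizeX_leq. Qed.

Section FilteredComb.
Variables (K : fieldType) (d N : nat) (g : nat -> {mpoly K[d]}).
Local Notation comb := (filtered_comb g N).

Lemma filtered_comb0 e : comb e 0.
Proof.
exists (fun=> 0); split=> [l|]; first by rewrite msize0.
by rewrite big1 // => l _; rewrite mul0r.
Qed.

Lemma filtered_comb_gen l c : (0 < l <= N)%N -> comb l (c%:MP * g l).
Proof.
move=> /andP[l0 lN]; exists (fun k => if k == l then c%:MP else 0); split=> [k|].
  by case: eqP => [->|_]; rewrite ?msize0 // msizeC subSnn leq_b1.
rewrite (bigD1_seq l) ?iota_uniq ?mem_index_iota ?l0 //= eqxx big1 ?addr0 // => k.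
by move=> /negbTE->; rewrite mul0r.
Qed.

Lemma filtered_comb_leq e e' r : (e <= e')%N -> comb e r -> comb e' r.
Proof.
move=> le_e [q [qe ->]]; exists q; split=> // l.
by rewrite (leq_trans (qe l)) // leq_sub2r.
Qed.

Lemma filtered_combD e r s : comb e r -> comb e s -> comb e (r + s).
Proof.
move=> [q [qe ->]] [p [pe ->]]; exists (fun l => q l + p l); split=> [l|].
  by rewrite msizeD_leq.
by rewrite -big_split; apply: eq_bigr => l _; rewrite mulrDl.
Qed.

Lemma filtered_combM e m r s : (msize s <= m.+1)%N -> comb e r -> comb (e + m) (s * r).
Proof.
move=> sm [q [qe ->]]; exists (fun l => q l * s); split=> [l|]; last first.
  by rewrite mulr_sumr; apply: eq_bigr => l _; rewrite mulrCA mulrA.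
have [->|q0] := eqVneq (q l) 0; first by rewrite mul0r msize0.
have := qe l; have : (0 < msize (q l))%N by rewrite lt0n msize_poly_eq0.
move=> qgt qle; have -> : ((e + m).+1 - l = e.+1 - l + m)%N.
  by move: (mmeasure _ _) qgt qle => k; lia.
by rewrite msizeM_leq.
Qed.

Lemma filtered_combZ e c r : comb e r -> comb e (c%:MP * r).
Proof.
by move=> re; rewrite -[e]addn0; apply: filtered_combM re; rewrite msizeC leq_b1.
Qed.

Lemma filtered_comb_sum I (s : seq I) (P : pred I) (F : I -> {mpoly K[d]}) e :
  (forall i, P i -> comb e (F i)) -> comb e (\sum_(i <- s | P i) F i).
Proof.
move=> Fe; elim/big_rec: _ => [|i r Pi re]; first exact: filtered_comb0.
by apply: filtered_combD => //; apply: Fe.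
Qed.

(** The usual argument that nilpotent elements are stable under sums: each term
    of the binomial expansion contains a^k or b^m.  The degrees add up because a
    and b have degree at most one. *)
Lemma filtered_comb_nilpotentD a b :
    (msize a <= 2)%N -> (msize b <= 2)%N ->
    (exists m, comb m (a ^+ m)) -> (exists m, comb m (b ^+ m)) ->
  exists m, comb m ((a + b) ^+ m).
Proof.
move=> sa sb [k ak] [m bm]; exists (k + m)%N.
rewrite exprDn; apply: filtered_comb_sum => -[i /=]; rewrite ltnS => ile _.
rewrite -mulr_natl -mpolyC_nat; apply: filtered_combZ.
have [mi|im] := leqP m i.
  have le_deg : (m + (k + m - i + (i - m)) <= k + m)%N by lia.
  apply: filtered_comb_leq le_deg _; rewrite -[in b ^+ i](subnK mi) exprD mulrA.
  by apply: filtered_combM bm; rewrite -addSn msizeM_leq ?msize_expr.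
have le_deg : (k + (i + (m - i)) <= k + m)%N by lia.
apply: filtered_comb_leq le_deg _.
have -> : (k + m - i = k + (m - i))%N by lia.
rewrite exprD mulrC [_ * a ^+ (m - i)]mulrC mulrA.
by apply: filtered_combM ak; rewrite -addSn msizeM_leq ?msize_expr.
Qed.

End FilteredComb.

Section Certificate.
Variables (K : fieldType) (n d N : nat) (V : 'M[K]_(n, d)) (xi : 'cV[K]_d).
Local Notation ev r := (r.@[fun j => xi j 0]).
Local Notation f := (formal_power_sum V).
Local Notation g := (centred_power_sum V xi).

Lemma centred_power_sum_eval l : ev (g l) = 0.
Proof. by rewrite mevalB mevalC formal_power_sum_eval subrr. Qed.

Lemma monomial_in_ideal (m : 'X_{1..d}) :
    (forall j, exists e, filtered_comb g N e ('X_j - (xi j 0)%:MP)) ->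
  exists e, filtered_comb g N e ('X_[m] - (ev 'X_[m])%:MP).
Proof.
move=> Xj.
pose P r := exists e, filtered_comb g N e (r - (ev r)%:MP).
have P1 : P 1 by exists 0%N; rewrite meval1 subrr; apply: filtered_comb0.
have PM r s : P r -> P s -> P (r * s).
  move=> [e re] [e' se']; exists (maxn (e + msize s) e')%N.
  have -> : r * s - (ev (r * s))%:MP
    = s * (r - (ev r)%:MP) + (ev r)%:MP * (s - (ev s)%:MP).
    by rewrite mevalM mpolyCM; ring.
  apply: filtered_combD.
    by apply: filtered_comb_leq (leq_maxl _ _) (filtered_combM _ re).
  by apply: filtered_comb_leq (leq_maxr _ _) (filtered_combZ _ se').
rewrite mpolyXE_id; apply: (big_ind P) => // j _.
elim: (m j) => [|k IHk]; first by rewrite expr0.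
rewrite exprS; apply: PM IHk; rewrite /P mevalXU; exact: Xj.
Qed.

(** In degree above D0, the sum of the m j, every monomial has some exponent at
    least m j.  Below that bound there are finitely many monomials, and the
    degrees of their cofactors have a maximum.  A monomial above the bound is a
    combination of the power sums that respects degrees; replacing each power
    sum by the centred one adds a polynomial of smaller degree, to which
    induction applies.  So the larger monomials cause no further growth. *)
Lemma exists_certificate :
    (forall j, exists e, filtered_comb g N e ('X_j - (xi j 0)%:MP)) ->
    (forall j, exists m, filtered_comb f N m ('X_j ^+ m)) ->
  exists2 D, (0 < D)%N & certified V xi N D.
Proof.
move=> Xideal /fin_all_exists[m mP].
pose D0 := (\sum_j m j)%N.
have /fin_all_exists[E EP] : forall a : 'X_{1..d < D0.+1}, exists e,
    filtered_comb g N e ('X_[a] - (ev 'X_[a])%:MP).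
  by move=> a; apply: monomial_in_ideal.
pose D := maxn 1 (maxn D0 (\max_a E a)).
exists D; first by rewrite leq_max.
suff cert k a : (mdeg a < k)%N -> (mdeg a <= D)%N ->
    filtered_comb g N D ('X_[a] - (ev 'X_[a])%:MP) by move=> a; apply: (cert (mdeg a).+1).
elim: k a => // k IHk a; rewrite ltnS => ak aD.
have [aD0|] := leqP (mdeg a) D0.
  have aD0' : (mdeg a < D0.+1)%N by [].
  apply: filtered_comb_leq (EP (BMultinom aD0')).
  rewrite (leq_trans (leq_bigmax (BMultinom aD0'))) //.
  by rewrite /D !leq_max leqnn !orbT.
move=> D0a.
have [j mja] : exists j, (m j <= a j)%N.
  apply/existsP; rewrite -[X in is_true X]negbK negb_exists; apply/negP => /forallP am.
  move: D0a; rewrite ltnNge mdegE leq_sum // => j _.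
  by have := am j; rewrite -ltnNge => /ltnW.
have [q [qa aE]] : filtered_comb f N (mdeg a) 'X_[a].
  have aE : a = (U_(j) *+ m j + (a - U_(j) *+ m j))%MM.
    apply/mnmP => i; rewrite mnmDE mnmBE mulmnE mnm1E.
    by case: eqP => [<-|_]; rewrite ?mul1n ?mul0n ?subnKC ?subn0.
  have -> : mdeg a = (m j + mdeg (a - U_(j) *+ m j))%N.
    by rewrite {1}aE mdegD mdegMn mdeg1 mul1n.
  rewrite {2}aE mpolyXD mulrC -mpolyXn; apply: filtered_combM (mP j).
  by rewrite msizeX.
(* The error made by centring the power sums; its degree is below that of the
   monomial because the index l is positive. *)
pose r := \sum_(1 <= l < N.+1) q l * (power_sum l (V *m xi))%:MP.
have XE : 'X_[a] = \sum_(1 <= l < N.+1) q l * g l + r.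
  by rewrite aE -big_split; apply: eq_bigr => l _; rewrite /= -mulrDr subrK.
have evXE : ev 'X_[a] = ev r.
  rewrite XE mevalD rmorph_sum big1 ?add0r // => l _.
  by rewrite /= mevalM centred_power_sum_eval mulr0.
have rsize : (msize r <= mdeg a)%N.
  rewrite /r big_nat msize_sum_leq // => l /andP[l0 _].
  rewrite -[mdeg a]addn0 msizeM_leq ?msizeC ?leq_b1 // (leq_trans (qa l)) //.
  by rewrite leq_subLR -add1n leq_add2r.
rewrite evXE XE -addrA; apply: filtered_combD.
  exists q; split=> // l; rewrite (leq_trans (qa l)) // leq_sub2r //.
have -> : r - (ev r)%:MP = \sum_(b : 'X_{1..d < mdeg a})
    (r@_b)%:MP * ('X_[b] - (ev 'X_[b])%:MP).
  have evE : ev r = \sum_(b : 'X_{1..d < mdeg a}) r@_b * ev 'X_[b].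
    by rewrite {1}(mpolywE rsize) rmorph_sum; apply: eq_bigr => b _; rewrite /= mevalZ.
  rewrite evE rmorph_sum {1}(mpolywE rsize) -sumrB; apply: eq_bigr => b _.
  by rewrite /= mulrBr mul_mpolyC mpolyCM.
apply: filtered_comb_sum => b _; apply: filtered_combZ.
have ba := bmdeg b; apply: IHk; first exact: leq_trans ak.
exact: leq_trans (ltnW ba) aD.
Qed.

End Certificate.

(** * Newton's identities *)

Section Newton.
Variable R : comNzRingType.
Implicit Types (s t : seq R) (y : R).

(** Up to the sign (-1)^k, the k-th elementary symmetric function of s. *)
Definition vieta s k : R := (\prod_(y <- s) (1 - 'X * y%:P))`_k.

Lemma vieta_nil k : vieta [::] k = (k == 0)%:R.
Proof. by rewrite /vieta big_nil coef1. Qed.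

Lemma vieta_cons y s k :
  vieta (y :: s) k = vieta s k - (if k is k'.+1 then y * vieta s k' else 0).
Proof.
rewrite /vieta big_cons mulrBl mul1r coefB -mulrA coefXM.
by case: k => // k; rewrite coefCM.
Qed.

Definition psum s l := \sum_(y <- s) y ^+ l.

Lemma vieta0 s : vieta s 0 = 1.
Proof. by elim: s => [|y s IHs]; rewrite ?vieta_nil // vieta_cons IHs subr0. Qed.

Lemma vieta_default s k : (size s < k)%N -> vieta s k = 0.
Proof.
elim: s k => [|y s IHs] [|k] //= sk; first by rewrite vieta_nil.
by rewrite vieta_cons !IHs ?mulr0 ?subr0 // ltnW.
Qed.

Lemma prod_vieta s x :
  \prod_(y <- s) (x - y) = \sum_(k < (size s).+1) vieta s k * x ^+ (size s - k).
Proof.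
elim: s => [|y s IHs]; first by rewrite big_nil big_ord1 vieta_nil mul1r.
rewrite big_cons IHs mulrBl [size (_ :: _)]/=.
under [RHS]eq_bigr do rewrite vieta_cons mulrBl; rewrite sumrB; congr (_ - _).
  rewrite [RHS]big_ord_recr /=. rewrite vieta_default // mul0r addr0 mulr_sumr.
  apply: eq_bigr => k _; rewrite mulrCA -exprS subSn //.
  by rewrite -ltnS.
rewrite [RHS]big_ord_recl /= mul0r add0r mulr_sumr.
by apply: eq_bigr => k _; rewrite mulrA /= subSS.
Qed.

(** Induction on s: adjoining y multiplies the generating polynomial by 1 - Xy
    and adds y^l to the l-th power sum; the new terms telescope.  The identity
    extends to all k, since the coefficients beyond the size of s vanish. *)
Lemma newton s k :
  k%:R * vieta s k + \sum_(i < k) vieta s i * psum s (k - i) = 0.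
Proof.
elim: s k => [|y s IHs] k.
  rewrite big1 => [|i _]; last by rewrite /psum big_nil mulr0.
  by case: k => [|k]; rewrite vieta_nil ?mul0r ?mulr0 addr0.
case: k => [|k]; first by rewrite mul0r big_ord0 addr0.
have psumE l : psum (y :: s) l = y ^+ l + psum s l by rewrite /psum big_cons.
pose v i : R := if i is i'.+1 then y * vieta s i' else 0.
have split1 : \sum_(i < k.+1) vieta (y :: s) i * psum (y :: s) (k.+1 - i)
  = \sum_(i < k.+1) (vieta s i - v i) * y ^+ (k.+1 - i)
    + (\sum_(i < k.+1) vieta s i * psum s (k.+1 - i)
       - y * \sum_(i < k) vieta s i * psum s (k - i)).
  have -> : y * \sum_(i < k) vieta s i * psum s (k - i)
      = \sum_(i < k.+1) v i * psum s (k.+1 - i).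
    rewrite big_ord_recl /= mul0r add0r mulr_sumr.
    by apply: eq_bigr => i _; rewrite /= subSS mulrA.
  rewrite -sumrB -big_split; apply: eq_bigr => i _.
  by rewrite psumE vieta_cons -/(v i) /=; ring.
have telescope : \sum_(i < k.+1) (vieta s i - v i) * y ^+ (k.+1 - i) = y * vieta s k.
  under eq_bigr do rewrite mulrBl; rewrite sumrB big_ord_recr /= subSnn expr1.
  rewrite [X in _ - X]big_ord_recl /= mul0r add0r addrAC.
  rewrite [X in X - _](_ : _ = \sum_(i < k) v i.+1 * y ^+ (k - i)).
    by rewrite subrr add0r mulrC.
  apply: eq_bigr => i _; rewrite subSn ?exprS /=; [by ring | exact: ltnW].
rewrite split1 telescope vieta_cons.
transitivity ((k.+1%:R * vieta s k.+1 + \sum_(i < k.+1) vieta s i * psum s (k.+1 - i))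
  - y * (k%:R * vieta s k + \sum_(i < k) vieta s i * psum s (k - i))).
  by rewrite -[k.+1]addn1 natrD; ring.
by rewrite !IHs mulr0 subr0.
Qed.

End Newton.

(** * Ideals containing differences of power sums *)

(** Ideals are predicates in Prop because those used below are defined by the
    existence of cofactors, and by quotients of such ideals. *)
Record ideal (R : comNzRingType) (J : R -> Prop) : Prop := Ideal {
  ideal0 : J 0;
  idealD : forall a b, J a -> J b -> J (a + b);
  idealM : forall r a, J a -> J (r * a)
}.

Section Ideals.
Variables (R : comNzRingType) (J : R -> Prop) (idJ : ideal J).

Lemma idealN a : J a -> J (- a).
Proof. by rewrite -mulN1r; apply: idealM. Qed.

Lemma idealB a b : J a -> J b -> J (a - b).
Proof. by move=> Ja Jb; apply: idealD => //; apply: idealN. Qed.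

Lemma ideal_sum I (s : seq I) (P : pred I) (F : I -> R) :
  (forall i, P i -> J (F i)) -> J (\sum_(i <- s | P i) F i).
Proof.
move=> JF; elim/big_rec: _ => [|i a Pi Ja]; first exact: ideal0.
by apply: idealD => //; apply: JF.
Qed.

Lemma vieta_congruence N (s t : seq R) :
    (forall k, (0 < k <= N)%N -> exists u : R, u * k%:R = 1) ->
    (forall l, (0 < l <= N)%N -> J (psum s l - psum t l)) ->
  forall k, (k <= N)%N -> J (vieta s k - vieta t k).
Proof.
move=> invN Jpsum k; elim/ltn_ind: k => -[_ _|k IHk kN].
  by rewrite !vieta0 subrr; apply: ideal0.
have [u uk] : exists u : R, u * k.+1%:R = 1 by apply: invN.
have vE (w : seq R) : vieta w k.+1
    = - (u * \sum_(i < k.+1) vieta w i * psum w (k.+1 - i)).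
  apply/eqP; rewrite -addr_eq0 -[vieta w k.+1]mul1r -uk -mulrA -mulrDr.
  by rewrite newton mulr0.
rewrite !vE -opprD -mulrN -mulrDr; apply: idealN; apply: (idealM idJ).
rewrite -sumrB; apply: ideal_sum => i _.
have -> : vieta s i * psum s (k.+1 - i) - vieta t i * psum t (k.+1 - i)
  = psum s (k.+1 - i) * (vieta s i - vieta t i)
    + vieta t i * (psum s (k.+1 - i) - psum t (k.+1 - i)) by ring.
apply: (idealD idJ); apply: (idealM idJ).
  by apply: IHk => //; apply: ltnW; apply: leq_trans kN.
by apply: Jpsum; rewrite subn_gt0 ltn_ord (leq_trans (leq_subr _ _)).
Qed.

(** Modulo J the product is the value at y of the monic polynomial with roots s,
    and y is one of these roots. *)
Lemma prod_root_congruence (s t : seq R) y :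
    size s = size t -> y \in s ->
    (forall k, (k <= size s)%N -> J (vieta s k - vieta t k)) ->
  J (\prod_(c <- t) (y - c)).
Proof.
move=> eq_sz ys Jv; rewrite -[\prod_(c <- t) _]subr0.
have <- : \prod_(c <- s) (y - c) = 0.
  by rewrite (perm_big _ (perm_to_rem ys)) /= big_cons subrr mul0r.
rewrite !prod_vieta eq_sz -sumrB; apply: ideal_sum => k _.
rewrite -mulrBl mulrC -opprB; apply/(idealM idJ)/idealN/Jv.
by rewrite eq_sz -ltnS.
Qed.

End Ideals.

Section Splitting.
Variables (K : fieldType) (R : comNzRingType) (phi : {rmorphism K -> R}).

Lemma prod_shift_eval (S : seq K) (y : R) s :
  exists u, \prod_(c <- S) (y - phi c)
    = phi (\prod_(c <- S) (s - c)) + (y - phi s) * u.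
Proof.
elim: S => [|c S [u IHS]]; first by exists 0; rewrite !big_nil rmorph1 mulr0 addr0.
exists (phi (\prod_(c <- S) (s - c)) + u * (y - phi c)).
by rewrite !big_cons IHS rmorphM rmorphB /=; ring.
Qed.

(** A case of the Chinese remainder theorem: the factors y - s are pairwise
    comaximal, so J is the intersection of the ideals J + (y - s).  The induction
    on S passes to the colon ideal of J by y - s. *)
Lemma ideal_split (S : seq K) (J : R -> Prop) (y z : R) :
    ideal J -> uniq S -> J (\prod_(c <- S) (y - phi c)) ->
    (forall s, s \in S -> exists r, J (z - r * (y - phi s))) ->
  J z.
Proof.
elim: S J => [|s S IHS] J idJ /=.
  by move=> _; rewrite big_nil -{2}[z]mulr1 => J1 _; apply: idealM.
case/andP=> sS uS; rewrite big_cons => Jprod Jz.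
(* The colon ideal of J by y - s. *)
pose J' r := J ((y - phi s) * r).
have idJ' : ideal J'.
  split=> [|a b Ja Jb|r a Ja]; rewrite /J'.
  - by rewrite mulr0; apply: ideal0.
  - by rewrite mulrDr; apply: idealD.
  - by rewrite mulrCA; apply: idealM.
have J'z : J' z.
  apply: IHS => // c cS; have [|r Jr] := Jz c; first by rewrite inE cS orbT.
  by exists r; apply: idealM.
have [u uE] := prod_shift_eval S y s; move: Jprod; rewrite uE.
set b := \prod_(c <- S) (s - c) => Jprod.
have b0 : b != 0.
  rewrite prodf_seq_neq0; apply/allP => c cS; rewrite subr_eq0.
  by apply: contraNneq sS => ->.
have [|r Jr] := Jz s; first exact: mem_head.
have -> : z = phi b^-1 * (((phi b + (y - phi s) * u) * (z - r * (y - phi s))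
    + r * ((y - phi s) * (phi b + (y - phi s) * u))) - u * ((y - phi s) * z)).
  have -> : ((phi b + (y - phi s) * u) * (z - r * (y - phi s))
    + r * ((y - phi s) * (phi b + (y - phi s) * u))) - u * ((y - phi s) * z) = phi b * z.
    by ring.
  by rewrite mulrA -rmorphM mulVf // rmorph1 mul1r.
apply: idealM => //; apply: idealB => //; last exact: idealM.
by apply: idealD => //; apply: idealM.
Qed.

(** Iterating over ys: to prove membership in J, each y in ys may be assumed
    congruent to a constant.  Each
    assumption enlarges the ideal by one linear factor. *)
Lemma ideal_split_seq (S : seq K) (z : R) (ys : seq R) (J : R -> Prop) :
    ideal J -> uniq S -> (forall y, y \in ys -> J (\prod_(c <- S) (y - phi c))) ->
    (forall (J' : R -> Prop) (t : seq K),
       ideal J' -> (forall r, J r -> J' r) -> size t = size ys ->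
       (forall i, (i < size ys)%N -> J' (ys`_i - phi t`_i)) -> J' z) ->
  J z.
Proof.
elim: ys J => [|y ys IHys] J idJ uS Jys Jz; first by apply: (Jz J [::]).
apply: (ideal_split idJ uS (Jys y (mem_head _ _))) => s _.
(* The ideal generated by J and y - s. *)
pose J1 a := exists r, J (a - r * (y - phi s)).
have JJ1 a : J a -> J1 a by exists 0; rewrite mul0r subr0.
have idJ1 : ideal J1.
  split=> [|a b [r Jr] [r' Jr']|c a [r Jr]].
  - by apply: JJ1; apply: ideal0.
  - by exists (r + r'); rewrite mulrDl opprD addrACA; apply: idealD.
  - by exists (c * r); rewrite -mulrA -mulrBr; apply: idealM.
change (J1 z); apply: IHys => // [x xys|J' t idJ' J1J' st J't].
  by apply/JJ1/Jys; rewrite inE xys orbT.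
apply: (Jz J' (s :: t)) => //= [r /JJ1/J1J'//||[_|i ilt]]; first by rewrite st.
  by apply/J1J'; exists 1; rewrite mul1r subrr; apply: ideal0.
exact: J't.
Qed.

End Splitting.

(** * Power sums together with one linear relation *)

Lemma psum_mkseq (R : comNzRingType) (x : nat -> R) N l :
  psum (mkseq x N) l = \sum_(i < N) x i ^+ l.
Proof.
by rewrite /psum big_map -(big_mkord xpredT (fun i => x i ^+ l)) /index_iota subn0.
Qed.

(** Each element of s is a root of the polynomial with roots t; s being free of
    duplicates, it exhausts t. *)
Lemma psum_perm_eq (K : fieldType) (N : nat) (s t : seq K) :
    (forall k, (0 < k <= N)%N -> k%:R != 0 :> K) ->
    size s = N -> size t = N -> uniq s ->
    (forall l, (0 < l <= N)%N -> psum s l = psum t l) ->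
  perm_eq t s.
Proof.
move=> invN sN tN us eq_psum.
have id0 : ideal (fun r : K => r = 0).
  by split=> [|a b -> ->|r a ->] //; rewrite ?addr0 ?mulr0.
have sub_st : {subset s <= t}.
  move=> y ys; have : \prod_(c <- t) (y - c) = 0.
    apply: (prod_root_congruence id0 (s := s)); rewrite ?tN // => k kN.
    apply: (vieta_congruence id0 (N := N)); rewrite -?sN //.
      by rewrite sN => j jN; exists j%:R^-1; rewrite mulVf // invN.
    by rewrite sN => l lN; rewrite eq_psum // subrr.
  by move/eqP; rewrite prodf_seq_eq0 => /hasP[c ct]; rewrite subr_eq0 => /eqP->.
have size_ts : (size t <= size s)%N by rewrite sN tN.
have [_ eq_st] := uniq_min_size us sub_st size_ts.
by apply: uniq_perm => //; first exact: leq_size_uniq us sub_st size_ts.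
Qed.

(** After splitting, the y i are congruent to constants t i.  If the power sums of
    t differ from those of c, or if t violates the linear relation, then a
    nonzero constant lies in the ideal and there is nothing left to prove.
    Otherwise t is a permutation of c satisfying the relation, so t = c. *)
Lemma psum_ideal_point (K : fieldType) (R : comNzRingType)
    (phi : {rmorphism K -> R}) (J : R -> Prop) (N : nat)
    (w c : nat -> K) (y : nat -> R) :
    ideal J -> (forall k, (0 < k <= N)%N -> k%:R != 0 :> K) ->
    (forall l, (0 < l <= N)%N -> J (psum (mkseq y N) l - phi (psum (mkseq c N) l))) ->
    \sum_(i < N) phi (w i) * y i = 0 -> \sum_(i < N) w i * c i = 0 ->
    (forall s : 'S_N, s != 1%g -> \sum_(i < N) w i * c (s i) != 0) ->
  forall i, (i < N)%N -> J (y i - phi (c i)).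
Proof.
move=> idJ invN Jpsum wy wc wcs i iN.
(* If c a = c b, the transposition of a and b would preserve the relation. *)
have uc : uniq (mkseq c N).
  apply/mkseq_uniqP => a b aN bN cab; apply/eqP/negPn/negP => neq_ab.
  have /wcs/eqP : tperm (Ordinal aN) (Ordinal bN) != 1%g.
    apply: contraNneq neq_ab => /permP/(_ (Ordinal aN)).
    by rewrite tpermL perm1 => /(congr1 val)/= ->.
  case; rewrite -[RHS]wc; apply: eq_bigr => k _.
  by case: tpermP => [->|->|//]; rewrite /= cab.
pose cs := mkseq c N.
have phi_psum t l : phi (psum t l) = psum (map phi t) l.
  by rewrite /psum rmorph_sum big_map; apply: eq_bigr => a _; rewrite rmorphXn.
apply: (ideal_split_seq (phi := phi) (ys := mkseq y N) idJ uc).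
  move=> a aY; rewrite -(big_map phi xpredT (fun b => a - b)).
  apply: (prod_root_congruence idJ (s := mkseq y N)); rewrite ?size_map //.
  rewrite size_iota; apply: (vieta_congruence idJ) => [k kN|l lN].
    by exists (phi k%:R^-1); rewrite -(rmorph_nat phi) -rmorphM mulVf ?rmorph1 ?invN.
  by rewrite -phi_psum; apply: Jpsum.
move=> J' t idJ' JJ'; rewrite size_mkseq => tN J't.
have {}J't k : (k < N)%N -> J' (y k - phi t`_k).
  by move=> kN; have := J't k kN; rewrite nth_mkseq.
have J'unit a : a != 0 -> J' (phi a) -> J' (y i - phi (c i)).
  move=> a0 J'a; rewrite -[_ - _]mulr1 -(rmorph1 phi) -(mulVf a0) rmorphM mulrA.
  exact: idealM.
have tE : t = mkseq (nth 0 t) N by rewrite -tN mkseq_nth.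
case: (boolP [forall l : 'I_N, psum cs l.+1 == psum t l.+1]); last first.
  case/forallPn=> l; rewrite -subr_eq0 => /J'unit; apply.
  have -> : phi (psum cs l.+1 - psum t l.+1)
    = (psum (mkseq y N) l.+1 - phi (psum t l.+1))
      - (psum (mkseq y N) l.+1 - phi (psum cs l.+1)) by rewrite rmorphB /=; ring.
  apply: idealB => //; last by apply/JJ'/Jpsum; rewrite /= ltn_ord.
  rewrite tE !psum_mkseq rmorph_sum -sumrB; apply: ideal_sum => // k _.
  by rewrite rmorphXn subrXX mulrC; apply: idealM => //; apply: J't.
move/forallP => eq_psum.
have /(psum_perm_eq invN (size_mkseq c N) tN uc)/= perm_t : forall l, (0 < l <= N)%N ->
    psum cs l = psum t l.
  by move=> [//|l] /= lN; apply/eqP/(eq_psum (Ordinal lN)).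
have szc : size cs == N by rewrite size_mkseq.
have /tuple_permP[s ts] : perm_eq t (Tuple szc) by [].
have tk (k : 'I_N) : t`_k = c (s k).
  by rewrite ts nth_mktuple (tnth_nth 0) /= nth_mkseq.
have [s1|/wcs/J'unit] := eqVneq s 1%g.
  by have := J't i iN; rewrite -[i in t`_i]/(val (Ordinal iN)) tk s1 perm1.
apply; have -> : phi (\sum_(k < N) w k * c (s k))
    = - \sum_(k < N) phi (w k) * (y k - phi t`_k).
  under [in RHS]eq_bigr do rewrite mulrBr tk -rmorphM.
  by rewrite sumrB wy sub0r opprK rmorph_sum.
by apply: idealN => //; apply: ideal_sum => // k _; apply: idealM => //; apply: J't.
Qed.

(** * A bidiagonal Toeplitz matrix *)

Definition extend (R : nmodType) d (x : 'I_d -> R) (i : nat) : R :=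
  if insub i is Some j then x j else 0.

Lemma extend_lt (R : nmodType) d (x : 'I_d -> R) (i : 'I_d) : extend x i = x i.
Proof. by rewrite /extend valK. Qed.

Lemma extend_ge (R : nmodType) d (x : 'I_d -> R) i : (d <= i)%N -> extend x i = 0.
Proof. by move=> di; rewrite /extend insubF // ltnNge di. Qed.

Definition bidiag (R : pzRingType) (q : R) (x : nat -> R) i :=
  q * x i - (if i is i'.+1 then x i' else 0).

Definition bidiag_mx (K : fieldType) n d (q : K) : 'M[K]_(n, d) :=
  \matrix_(i, j) (q * (i == j :> nat)%:R - (i == j.+1 :> nat)%:R).

Lemma toeplitz_bidiag_mx (K : fieldType) n d (q : K) : toeplitz (@bidiag_mx K n d q).
Proof.
move=> i i' j j' eqij; rewrite !mxE.
have -> : (i == j :> nat) = (i' == j' :> nat) by lia.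
by have -> : (i == j.+1 :> nat) = (i' == j'.+1 :> nat) by lia.
Qed.

Lemma sum_delta (R : pzRingType) d (x : 'I_d -> R) i :
  \sum_(j < d) (i == j :> nat)%:R * x j = extend x i.
Proof.
have [id|di] := ltnP i d.
  rewrite (bigD1 (Ordinal id)) //= eqxx mul1r big1 ?addr0 => [|j].
    by rewrite -[i in RHS]/(val (Ordinal id)) extend_lt.
  by rewrite -val_eqE eq_sym /= => /negbTE->; rewrite mul0r.
rewrite extend_ge // big1 // => j _.
by rewrite gtn_eqF ?mul0r // (leq_trans (ltn_ord j)).
Qed.

Lemma bidiag_mx_mul (K : fieldType) (R : comNzRingType) (phi : {rmorphism K -> R})
    n d q (x : 'I_d -> R) i :
  (map_mx phi (@bidiag_mx K n d q) *m \col_j x j) i 0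
    = bidiag (phi q) (extend x) i.
Proof.
rewrite !mxE /bidiag -sum_delta mulr_sumr.
have -> : (if val i is i'.+1 then extend x i' else 0)
    = \sum_(j < d) (val i == j.+1)%:R * x j.
  case: (val i) => [|i']; last by rewrite -sum_delta.
  by rewrite big1 // => j _; rewrite mul0r.
rewrite -sumrB; apply: eq_bigr => j _.
by rewrite !mxE rmorphB rmorphM !rmorph_nat mulrBl mulrA.
Qed.

Lemma bidiag_ge (R : pzRingType) q d (x : 'I_d -> R) i :
  (d < i)%N -> bidiag q (extend x) i = 0.
Proof.
by case: i => // i di; rewrite /bidiag !extend_ge ?mulr0 ?subr0 // ltnW.
Qed.

Lemma bidiag_mx_power_sum (K : fieldType) (R : comNzRingType)
    (phi : {rmorphism K -> R}) n d q (x : 'I_d -> R) l :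
    (d < n)%N -> (0 < l)%N ->
  power_sum l (map_mx phi (@bidiag_mx K n d q) *m \col_j x j)
    = psum (mkseq (bidiag (phi q) (extend x)) d.+1) l.
Proof.
move=> dn l0; rewrite psum_mkseq /power_sum.
under eq_bigr do rewrite bidiag_mx_mul.
rewrite -!(big_mkord xpredT (fun i => bidiag (phi q) (extend x) i ^+ l)).
rewrite (big_cat_nat (leq0n d.+1) dn) //= [X in _ + X]big_nat.
rewrite [X in _ + X]big1 ?addr0 // => i /andP[di _].
by rewrite bidiag_ge // expr0n gtn_eqF.
Qed.

(** Summation by parts; with Q i = q^i all coefficients on the right vanish, which
    is the linear relation satisfied by the entries of the product. *)
Lemma bidiag_weighted_sum (R : comNzRingType) q d (x : 'I_d -> R) (Q : nat -> R) :
  \sum_(i < d.+1) Q i * bidiag q (extend x) i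
    = \sum_(j < d) (Q j * q - Q j.+1) * x j.
Proof.
under eq_bigr do rewrite mulrBr; rewrite sumrB big_ord_recr /= extend_ge // !mulr0 addr0.
rewrite [X in _ - X]big_ord_recl /= mulr0 add0r -sumrB; apply: eq_bigr => j _.
by rewrite extend_lt mulrBl mulrA.
Qed.

Lemma exists_injective_powers (K : fieldType) m : infinite_type K ->
  exists q : K, forall a b, (a <= m)%N -> (b <= m)%N -> q ^+ a = q ^+ b -> a = b.
Proof.
move=> infK.
pose P : {poly K} :=
  \prod_(ab : 'I_m.+1 * 'I_m.+1 | ab.1 != ab.2) ('X^(val ab.1) - 'X^(val ab.2)).
have [|q Pq] := exists_nonroot infK (p := P).
  apply/prodf_neq0 => -[a b] /= neq_ab; rewrite subr_eq0; apply: contraNneq neq_ab.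
  move=> eqX; have := congr1 (fun p : {poly K} => size p) eqX.
  by rewrite !size_polyXn => -[] /val_inj ->.
exists q => a b am bm qab; apply/eqP/negPn/negP => neq_ab; case/eqP: Pq.
have am' : (a < m.+1)%N by [].
have bm' : (b < m.+1)%N by [].
rewrite /P (bigD1 (Ordinal am', Ordinal bm')) //= hornerM hornerD hornerN !hornerXn.
by rewrite qab subrr mul0r.
Qed.

Lemma shift_perm_id d (s : 'S_d.+1) :
  (forall j, (j < d)%N -> s (inord j.+1) = (s (inord j)).+1 :> nat) -> s = 1%g.
Proof.
move=> sS.
have sE j : (j <= d)%N -> s (inord j) = (s ord0 + j)%N :> nat.
  elim: j => [_|j IHj jd].
    by rewrite addn0; congr (val (s _)); apply/val_inj; rewrite /= inordK.
  by rewrite sS // IHj ?addnS // ltnW.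
have s0 : val (s ord0) = 0%N.
  have := ltn_ord (s (inord d)); rewrite sE //=; lia.
apply/permP => i; apply/val_inj; rewrite perm1 /=.
have id : (i <= d)%N by rewrite -ltnS.
by have := sE i id; rewrite inord_val s0.
Qed.

(** For the weights permuted by s, the coefficients of the x j vanish together only
    if s commutes with the successor, that is, if s is the identity.  The vector
    of powers of z then turns each linear form into a nonzero polynomial in z. *)
Lemma exists_separating_vector (K : fieldType) d (q : K) : infinite_type K ->
    (forall a b, (a <= d.+1)%N -> (b <= d.+1)%N -> q ^+ a = q ^+ b -> a = b) ->
  exists x : 'I_d -> K, forall s : 'S_d.+1, s != 1%g ->
    \sum_(i < d.+1) q ^+ i * bidiag q (extend x) (s i) != 0.
Proof.
move=> infK injq.
pose Q (s : 'S_d.+1) j := q ^+ s (inord j).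
pose P s : {poly K} := \poly_(j < d) (Q s j * q - Q s j.+1).
have P0 s : s != 1%g -> P s != 0.
  apply: contraNneq => Ps0; apply/eqP/shift_perm_id => j jd.
  have := congr1 (fun p : {poly K} => p`_j) Ps0; rewrite coef_poly jd coef0 => /eqP.
  rewrite subr_eq0 -exprSr => /eqP/injq -> //; exact: ltnW.
have [|z Pz] := exists_nonroot infK (p := \prod_(s | s != 1%g) P s).
  by apply/prodf_neq0 => s; apply: P0.
exists (fun j => z ^+ j) => s s1.
have -> : \sum_(i < d.+1) q ^+ i * bidiag q (extend (fun j : 'I_d => z ^+ j)) (s i)
    = (P s^-1%g).[z].
  rewrite horner_poly -(bidiag_weighted_sum q _ (Q s^-1%g)).
  rewrite [RHS](reindex_inj (@perm_inj _ s)); apply: eq_bigr => i _.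
  by rewrite /Q inord_val permK.
move: Pz; rewrite (bigD1 s^-1%g) ?hornerM; last by rewrite invg_eq1.
by rewrite mulf_eq0 negb_or => /andP[].
Qed.

(** * The certificate at the bidiagonal matrix *)

Section LinearForms.
Variables (K : fieldType) (d N : nat) (f : nat -> {mpoly K[d]}) (s : seq {mpoly K[d]}).
Hypothesis size_s : size s = N.
Hypothesis deg_s : forall y, y \in s -> (msize y <= 2)%N.
Hypothesis fE : forall l, (0 < l)%N -> f l = psum s l.
Hypothesis invN : forall k, (0 < k <= N)%N -> k%:R != 0 :> K.

Lemma msize_vieta k : (msize (vieta s k) <= k.+1)%N.
Proof.
elim: s deg_s k => [|y t IHt] deg k.
  by rewrite vieta_nil; case: eqP => _; rewrite ?msize1 ?msize0.
have {}IHt : forall k, (msize (vieta t k) <= k.+1)%N.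
  by apply: IHt => x xt; apply: deg; rewrite inE xt orbT.
rewrite vieta_cons msizeD_leq // msizeN.
case: k => [|k]; first by rewrite msize0.
by rewrite mulrC -[k.+2]addn1 msizeM_leq // deg ?mem_head.
Qed.

(** By Newton's identity, k times the k-th coefficient is a combination of the
    power sums of index at most k, with cofactors of complementary degree. *)
Lemma vieta_filtered k : (0 < k <= N)%N -> filtered_comb f N k (vieta s k).
Proof.
move=> kN; have := newton s k; rewrite addrC => /eqP; rewrite addr_eq0 => /eqP sumE.
have -> : vieta s k
    = (k%:R^-1)%:MP * ((-1)%:MP * \sum_(i < k) vieta s i * psum s (k - i)).
  rewrite sumE mpolyCN mulN1r opprK -mpolyC_nat mulrA -mpolyCM.
  by rewrite mulVf ?mul1r ?invN.
do 2!apply: filtered_combZ; apply: filtered_comb_sum => -[i /= ik] _.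
have [k0 kN'] := andP kN.
have -> : psum s (k - i) = f (k - i) by rewrite fE // subn_gt0.
exists (fun l => if l == (k - i)%N then vieta s i else 0); split=> [l|].
  case: eqP => [->|_]; last by rewrite msize0.
  by have := msize_vieta i; move: (mmeasure _ _) => v; lia.
rewrite (bigD1_seq (k - i)%N) ?iota_uniq //= => [|]; last first.
  by rewrite mem_index_iota; lia.
rewrite eqxx big1 ?addr0 // => l.
by move=> /negbTE->; rewrite mul0r.
Qed.

(** The element y is a root of the polynomial with roots s, whose lower
    coefficients are combinations of the power sums. *)
Lemma linear_form_nilpotent y : y \in s -> filtered_comb f N N (y ^+ N).
Proof.
move=> ys; have prod0 : \prod_(c <- s) (y - c) = 0.
  by rewrite (perm_big _ (perm_to_rem ys)) /= big_cons subrr mul0r.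
move: prod0; rewrite prod_vieta size_s big_ord_recl vieta0 mul1r subn0 => /eqP.
rewrite addr_eq0 => /eqP->; rewrite -mulN1r -mpolyCN; apply: filtered_combZ.
apply: filtered_comb_sum => -[k /= kN] _; rewrite mulrC.
have -> : filtered_comb f N N = filtered_comb f N (k.+1 + (N - k.+1)).
  by rewrite subnKC.
by apply: filtered_combM; [rewrite msize_expr ?deg_s | apply: vieta_filtered].
Qed.

End LinearForms.

Section BidiagonalCertificate.
Variables (K : fieldType) (n d : nat) (q : K) (x : 'I_d -> K).
Hypothesis dn : (d < n)%N.
Hypothesis q_neq0 : q != 0.
Local Notation V := (@bidiag_mx K n d q).
Local Notation xi := (\col_j x j).
Local Notation Y := (bidiag q%:MP_[d] (extend (fun j => 'X_j))).
Local Notation c := (bidiag q (extend x)).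

Lemma formal_power_sum_bidiag l : (0 < l)%N ->
  formal_power_sum V l = psum (mkseq Y d.+1) l.
Proof. exact: (bidiag_mx_power_sum (@mpolyC d K) q (fun j => 'X_j) dn). Qed.

Lemma power_sum_bidiag l : (0 < l)%N -> power_sum l (V *m xi) = psum (mkseq c d.+1) l.
Proof.
move=> l0; rewrite -[q in RHS]/(idfun q) -(bidiag_mx_power_sum _ _ _ dn l0).
by rewrite map_mx_id.
Qed.

(** Forward substitution; stated for a predicate because it serves both for
    membership in an ideal and for nilpotency. *)
Lemma bidiag_recover (S : comNzRingType) (phi : {rmorphism K -> S}) (P : S -> Prop)
    (X : 'I_d -> S) :
    P 0 -> (forall a b, P a -> P b -> P (a + b)) -> (forall k a, P a -> P (phi k * a)) ->
    (forall i, (i < d.+1)%N -> P (bidiag (phi q) (extend X) i)) ->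
  forall j, P (X j).
Proof.
move=> P0 PD PZ PY j; rewrite -extend_lt.
have := ltn_ord j; elim: (nat_of_ord j) => [|i IHi] id.
  have -> : extend X 0 = phi q^-1 * bidiag (phi q) (extend X) 0.
    by rewrite /bidiag subr0 mulrA -rmorphM mulVf // rmorph1 mul1r.
  by apply/PZ/PY.
have -> : extend X i.+1 = phi q^-1 * (bidiag (phi q) (extend X) i.+1 + extend X i).
  by rewrite /bidiag subrK mulrA -rmorphM mulVf // rmorph1 mul1r.
by apply/PZ/PD; [apply: PY; apply: ltnW | apply: IHi; apply: ltnW].
Qed.

Lemma msize_bidiag i : (msize (Y i) <= 2)%N.
Proof.
have extX k : (msize (extend (fun j => 'X_j : {mpoly K[d]}) k) <= 2)%N.
  have [kd|dk] := ltnP k d; last by rewrite extend_ge // msize0.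
  by rewrite -[k]/(val (Ordinal kd)) extend_lt msizeX mdeg1.
rewrite msizeD_leq //; first by rewrite -[2%N]/(1 + 1)%N msizeM_leq // msizeC leq_b1.
by rewrite msizeN; case: i => [|i] //; rewrite msize0.
Qed.

Lemma bidiag_certificate :
    (forall k, (0 < k <= d.+1)%N -> k%:R != 0 :> K) ->
    (forall s : 'S_d.+1, s != 1%g -> \sum_(i < d.+1) q ^+ i * c (s i) != 0) ->
  exists2 D, (0 < D)%N & certified V xi d.+1 D.
Proof.
move=> invN sep; apply: exists_certificate.
  pose g := centred_power_sum V xi; pose J r := exists e, filtered_comb g d.+1 e r.
  have idJ : ideal J.
    split=> [|a b [e ae] [e' be']|r a [e ae]].
    - by exists 0%N; apply: filtered_comb0.
    - exists (maxn e e'); apply: filtered_combD.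
        exact: filtered_comb_leq (leq_maxl _ _) ae.
      exact: filtered_comb_leq (leq_maxr _ _) be'.
    - by exists (e + msize r)%N; apply: filtered_combM ae.
  suff JX j : J ('X_j - (x j)%:MP) by move=> j; rewrite mxE; apply: JX.
  apply: (bidiag_recover (phi := @mpolyC d K) (X := fun j => 'X_j - (x j)%:MP)).
  - exact: ideal0.
  - exact: idealD.
  - by move=> k a; apply: idealM.
  have weights (S : comNzRingType) (p : S) (z : 'I_d -> S) :
      \sum_(i < d.+1) p ^+ i * bidiag p (extend z) i = 0.
    rewrite (bidiag_weighted_sum _ _ (fun i => p ^+ i)) big1 // => k _.
    by rewrite exprSr subrr mul0r.
  move=> i id.
  have -> : bidiag q%:MP (extend (fun j => 'X_j - (x j)%:MP)) i = Y i - (c i)%:MP.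
    have extB k : extend (fun j => 'X_j - (x j)%:MP_[d]) k
        = extend (fun j => 'X_j) k - (extend x k)%:MP.
      by rewrite /extend; case: insub => //; rewrite mpolyC0 subr0.
    rewrite /bidiag mpolyCB mpolyCM extB; case: i {id} => [|i].
      by rewrite mpolyC0; ring.
    by rewrite extB; ring.
  apply: (psum_ideal_point (phi := @mpolyC d K) (w := fun i => q ^+ i) idJ invN) id => //.
  - move=> l /andP[l0 lN]; rewrite -formal_power_sum_bidiag // -power_sum_bidiag //.
    exists l; rewrite -[X in _ l X]mul1r -mpolyC1.
    by apply: filtered_comb_gen; rewrite l0.
  - rewrite -[RHS](weights _ q%:MP (fun j => 'X_j)).
    by apply: eq_bigr => k _; rewrite rmorphXn.
  - exact: weights.
pose P (r : {mpoly K[d]}) :=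
  (msize r <= 2)%N /\ exists m, filtered_comb (formal_power_sum V) d.+1 m (r ^+ m).
suff PX j : P 'X_j by move=> j; case: (PX j).
apply: (bidiag_recover (phi := @mpolyC d K) (X := fun j => 'X_j)).
- split; first by rewrite msize0.
  by exists 1%N; rewrite expr1; apply: filtered_comb0.
- move=> a b [a2 aP] [b2 bP]; split; first exact: msizeD_leq.
  exact: filtered_comb_nilpotentD.
- move=> k a [a2 [m am]]; split.
    by rewrite -[2%N]/(1 + 1)%N msizeM_leq // msizeC leq_b1.
  by exists m; rewrite exprMn -rmorphXn; apply: filtered_combZ.
move=> i id; split; first exact: msize_bidiag.
exists d.+1; apply: (linear_form_nilpotent (s := mkseq Y d.+1)) => //.
- by rewrite size_mkseq.
- by move=> _ /mapP[k _ ->]; apply: msize_bidiag.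
- exact: formal_power_sum_bidiag.
- by apply/mapP; exists i; rewrite ?mem_iota.
Qed.

End BidiagonalCertificate.

(** The sum of the entries is (q - 1) x_0, so the first equation already
    determines x_0, in any characteristic. *)
Lemma one_variable_certificate (K : fieldType) n (q : K) (x : 'I_1 -> K) :
    (1 < n)%N -> q != 1 ->
  exists2 D, (0 < D)%N & certified (@bidiag_mx K n 1 q) (\col_j x j) 2 D.
Proof.
move=> n1 q1.
have q10 : q - 1 != 0 by rewrite subr_eq0.
have bidiag1 (S : comNzRingType) (p : S) (z : 'I_1 -> S) :
    psum (mkseq (bidiag p (extend z)) 2) 1 = (p - 1) * z 0.
  rewrite psum_mkseq !big_ord_recl big_ord0 /= /bidiag /= (extend_lt z 0).
  by rewrite extend_ge //; ring.
have fE : formal_power_sum (@bidiag_mx K n 1 q) 1 = (q - 1)%:MP * 'X_0.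
  by rewrite formal_power_sum_bidiag // bidiag1 mpolyCB mpolyC1.
apply: exists_certificate => j; rewrite (ord1 j).
  exists 1%N; have -> : 'X_0 - ((\col_j x j) 0 0)%:MP
      = ((q - 1)^-1)%:MP * centred_power_sum (@bidiag_mx K n 1 q) (\col_j x j) 1.
    rewrite /centred_power_sum fE power_sum_bidiag // bidiag1 mxE mpolyCM -mulrBr mulrA.
    by rewrite -mpolyCM mulVf // mpolyC1 mul1r.
  exact: filtered_comb_gen.
exists 1%N; have -> : 'X_0 ^+ 1
    = ((q - 1)^-1)%:MP * formal_power_sum (@bidiag_mx K n 1 q) 1 :> {mpoly K[1]}.
  by rewrite fE mulrA -mpolyCM mulVf // mpolyC1 mul1r expr1.
exact: filtered_comb_gen.
Qed.

(** * Generic uniqueness *)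

Theorem theorem8 (K : fieldType) (K_infinite : infinite_type K)
    (Kbar : closedFieldType) (iota : {rmorphism K -> Kbar})
    (Kbar_algebraic : integralRange iota)
    (n d : nat) (d_ge1 : (1 <= d)%N) (n_geSd : (d + 1 <= n)%N)
    (charK : (1 < d)%N -> (d.+1`!)%:R != 0 :> K) :
  generically (@toeplitz K n d) (fun V =>
    generically (fun _ : 'cV[K]_d => True) (fun xi =>
      forall Pi : 'M[K]_n, is_perm_mx Pi ->
      forall y : 'cV[K]_n, y = Pi *m V *m xi ->
      forall x : 'cV[Kbar]_d,
        (forall l : nat, (1 <= l <= d + 1)%N ->
           power_sum l (map_mx iota V *m x) = power_sum l (map_mx iota y))
        <-> x = map_mx iota xi)).
Proof.
have dn : (d < n)%N by rewrite -addn1.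
have [q injq] := exists_injective_powers d.+1 K_infinite.
have [x sep] := exists_separating_vector K_infinite injq.
(* The powers of q up to q^(d+1) are distinct, so in particular q, q^2 and 1, q. *)
have q0 : q != 0.
  apply/eqP => q0; suff: 1%N = 2%N by [].
  by apply: injq; rewrite // q0 !expr0n.
have q1 : q != 1.
  by apply/eqP => q1; suff: 0%N = 1%N by []; apply: injq; rewrite // q1 expr1n.
have [D D0 cert] : exists2 D, (0 < D)%N &
    certified (@bidiag_mx K n d q) (\col_j x j) d.+1 D.
  case: (ltngtP 1 d) d_ge1 => // [d1 _|d1 _]; last first.
    case: _ / d1 x sep {injq charK n_geSd} dn => x _ n1.
    exact: one_variable_certificate.
  apply: bidiag_certificate => // k /andP[k0 kd].
  apply: contraNneq (charK d1) => k_eq0.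
  have /dvdnP[m ->] : (k %| d.+1`!)%N by rewrite dvdn_fact ?k0.
  by rewrite natrM k_eq0 mulr0.
rewrite addn1; exact: generic_uniqueness K_infinite (@toeplitz_bidiag_mx K n d q) D0 cert.
Qed.
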